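(* Let $d\in\mathbb{N}$. Then the second Hochschild cohomology group of $\mathrm{Pol}(O_d^+)$ with trivial coefficients satisfies $$H^2(O_d^+,{}_\epsilon\mathbb{C}_\epsilon)\cong\mathbb{C}^{\frac{d(d-1)}{2}}.$$ Furthermore, for $d\ge3$ the set $\{[\widehat K_{m,n}]:m<n,\ m,n=1,\ldots,d\}$ is a basis of $H^2(O_d^+,{}_\epsilon\mathbb{C}_\epsilon)$, where $\widehat K_{m,n}$ are the 2-cocycles defined in the context.
   Context: $A=\mathrm{Pol}(O_d^+)$ is the universal unital $^*$-algebra generated by selfadjoint elements $u_{jk}=u_{jk}^*$, $1\le j,k\le d$, subject to the relations that $u=(u_{jk})$ is unitary. Its character $\epsilon$ is the unital $^*$-homomorphism to $\mathbb{C}$ with $\epsilon(u_{jk})=\delta_{jk}$. Hochschild cohomology with trivial coefficients ($\mathbb{C}$ as an $A$-bimodule via $a.z.b=\epsilon(a)\epsilon(b)z$): for linear $\phi:A^{\otimes(n-1)}\to\mathbb{C}$, $$(\partial^{n-1}\phi)(a_1\otimes\cdots\otimes a_n)=\epsilon(a_1)\phi(a_2\otimes\cdots\otimes a_n)+\sum_{j=1}^{n-1}(-1)^j\phi(a_1\otimes\cdots\otimes a_ja_{j+1}\otimes\cdots\otimes a_n)+(-1)^n\phi(a_1\otimes\cdots\otimes a_{n-1})\epsilon(a_n).$$ $Z^2=\{c\in L(A^{\otimes2};\mathbb{C}):\partial^2c=0\}$ (2-cocycles), $B^2=\{\partial^1\psi:\psi\in L(A;\mathbb{C})\}$ (coboundaries),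 $H^2(O_d^+,{}_\epsilon\mathbb{C}_\epsilon)=Z^2/B^2$, a complex vector space; $[c]$ is the class of $c$. For every $V\in M_d(\mathbb{C})$ with $V^t=-V$ there is a unique linear map $\eta_V:A\to\mathbb{C}$ with $\eta_V(ab)=\epsilon(a)\eta_V(b)+\eta_V(a)\epsilon(b)$ for all $a,b\in A$ (a Gaussian cocycle) and $\eta_V(u_{jk})=V_{jk}$. For such maps $\eta_1,\eta_2$, the formula $K(\eta_1,\eta_2)(a\otimes b)=\overline{\eta_1(a^* )}\,\eta_2(b)$ defines a 2-cocycle. Let $e_{jk}$ be the matrix units of $M_d(\mathbb{C})$ and $Z_{jk}=e_{jk}-e_{kj}$. For $d\ge3$ and $m<n$, choose $l\in\{1,\ldots,d\}$ different from both $m$ and $n$, and set $\widehat K_{m,n}=K(\eta_{Z_{lm}},\eta_{Z_{ln}})$. *)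

(* Defs.v *)
From HB Require Import structures.
From mathcomp Require Import all_boot all_order all_algebra.
From mathcomp Require Import generic_quotient ring_quotient.
From mathcomp Require Import boolp classical_sets functions reals.
From mathcomp Require Import complex ring.

Set Implicit Arguments.
Unset Strict Implicit.
Unset Printing Implicit Defensive.

Import Order.TTheory GRing.Theory Num.Theory.

Local Open Scope ring_scope.
Local Open Scope quotient_scope.

(* A unital *-algebra over C is an algType C with a map s satisfying is_star. *)
Definition is_star (C : numClosedFieldType) (B : algType C) (s : B -> B) :=
  [/\ involutive s,
      {morph s : x y / x + y},
      (forall (c : C) x, s (c *: x) = c^* *: s x)
    & forall x y, s (x * y) = s y * s x].

(* The matrix (v j k) over the *-algebra (B, s) has selfadjoint entries and is
   unitary: v v^* = v^* v = 1, where (v^* )_(j, k) = s (v k j). *)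
Definition orthogonal_matrix (C : numClosedFieldType) (B : algType C)
    (s : B -> B) (d : nat) (v : 'I_d -> 'I_d -> B) :=
  [/\ forall j k, s (v j k) = v j k,
      forall j k, \sum_(p < d) v j p * s (v k p) = (j == k)%:R
    & forall j k, \sum_(p < d) s (v p j) * v p k = (j == k)%:R].

Inductive term (C : Type) (d : nat) : Type :=
| TGen of 'I_d & 'I_d
| TZero
| TOne
| TAdd of term C d & term C d
| TScale of C & term C d
| TMul of term C d & term C d
| TStar of term C d.

Arguments TGen {C d} _ _.
Arguments TZero {C d}.
Arguments TOne {C d}.

HB.instance Definition _ (C : Type) d := gen_eqMixin (term C d).
HB.instance Definition _ (C : Type) d := gen_choiceMixin (term C d).

(* PolO below, the model of Pol(O_d^+), is the quotient of terms by the smallest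
   congruence that contains the axioms of unital *-algebras and the relations
   saying that (u_jk) = (TGen j k) is unitary with selfadjoint entries; its
   universal property is PolO_universal. *)
Inductive teq (C : numClosedFieldType) (d : nat) : term C d -> term C d -> Prop :=
| teq_refl t : teq t t
| teq_sym t u : teq t u -> teq u t
| teq_trans t u v : teq t u -> teq u v -> teq t v
| teq_add t t' u u' : teq t t' -> teq u u' -> teq (TAdd t u) (TAdd t' u')
| teq_scale c t t' : teq t t' -> teq (TScale c t) (TScale c t')
| teq_mul t t' u u' : teq t t' -> teq u u' -> teq (TMul t u) (TMul t' u')
| teq_star t t' : teq t t' -> teq (TStar t) (TStar t')
| teq_addA t u v : teq (TAdd t (TAdd u v)) (TAdd (TAdd t u) v)
| teq_addC t u : teq (TAdd t u) (TAdd u t)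
| teq_add0 t : teq (TAdd TZero t) t
| teq_addN t : teq (TAdd (TScale (-1) t) t) TZero
| teq_scaleA a b t : teq (TScale a (TScale b t)) (TScale (a * b) t)
| teq_scale1 t : teq (TScale 1 t) t
| teq_scaleDr a t u : teq (TScale a (TAdd t u)) (TAdd (TScale a t) (TScale a u))
| teq_scaleDl a b t : teq (TScale (a + b) t) (TAdd (TScale a t) (TScale b t))
| teq_mulA t u v : teq (TMul t (TMul u v)) (TMul (TMul t u) v)
| teq_mul1t t : teq (TMul TOne t) t
| teq_mult1 t : teq (TMul t TOne) t
| teq_mulDl t u v : teq (TMul (TAdd t u) v) (TAdd (TMul t v) (TMul u v))
| teq_mulDr t u v : teq (TMul t (TAdd u v)) (TAdd (TMul t u) (TMul t v))
| teq_scaleAl a t u : teq (TScale a (TMul t u)) (TMul (TScale a t) u)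
| teq_scaleAr a t u : teq (TScale a (TMul t u)) (TMul t (TScale a u))
| teq_starK t : teq (TStar (TStar t)) t
| teq_starD t u : teq (TStar (TAdd t u)) (TAdd (TStar t) (TStar u))
| teq_starZ a t : teq (TStar (TScale a t)) (TScale a^* (TStar t))
| teq_starM t u : teq (TStar (TMul t u)) (TMul (TStar u) (TStar t))
| teq_gen_star j k : teq (TStar (TGen j k)) (TGen j k)
| teq_unitaryl j k :
    teq (\big[@TAdd C d/TZero]_(p < d) TMul (TGen j p) (TStar (TGen k p)))
        (if j == k then TOne else TZero)
| teq_unitaryr j k :
    teq (\big[@TAdd C d/TZero]_(p < d) TMul (TStar (TGen p j)) (TGen p k))
        (if j == k then TOne else TZero).

Section TermEval.
Variables (C : numClosedFieldType) (d : nat).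

Fixpoint teval (B : algType C) (s : B -> B) (v : 'I_d -> 'I_d -> B)
    (t : term C d) : B :=
  match t with
  | TGen j k => v j k
  | TZero => 0
  | TOne => 1
  | TAdd t u => teval s v t + teval s v u
  | TScale c t => c *: teval s v t
  | TMul t u => teval s v t * teval s v u
  | TStar t => s (teval s v t)
  end.

Lemma teval_teq (B : algType C) (s : B -> B) v t u :
  is_star s -> orthogonal_matrix s v -> teq t u -> teval s v t = teval s v u.
Proof.
move=> [sK sD sZ sM] [vs vl vr].
have evb (F : 'I_d -> term C d) :
    teval s v (\big[@TAdd C d/TZero]_(p < d) F p) = \sum_(p < d) teval s v (F p).
  exact: (big_morph (teval s v) (fun=> fun=> erefl) erefl).
have evif (b : bool) : teval s v (if b then TOne else TZero) = b%:R by case: b.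
elim=> //= {t u} *; rewrite ?evb ?evif; do ?congruence.
- by rewrite addrA.
- by rewrite addrC.
- by rewrite add0r.
- by rewrite scaleN1r addNr.
- by rewrite scalerA.
- by rewrite scale1r.
- by rewrite scalerDr.
- by rewrite scalerDl.
- by rewrite mulrA.
- by rewrite mul1r.
- by rewrite mulr1.
- by rewrite mulrDl.
- by rewrite mulrDr.
- by rewrite scalerAl.
- by rewrite scalerAr.
- exact: vl.
- exact: vr.
Qed.

Lemma conj_star : is_star (Num.conj : C^o -> C^o).
Proof.
split.
- exact: conjCK.
- by move=> x y; rewrite rmorphD.
- by move=> c x; exact: rmorphM.
- by move=> x y; rewrite rmorphM mulrC.
Qed.

Definition delta (j k : 'I_d) : C^o := (j == k)%:R.

Lemma delta_orthogonal : orthogonal_matrix (Num.conj : C^o -> C^o) delta.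
Proof.
have ds j k : (delta j k)^* = delta j k by exact: conjC_nat.
split=> // j k.
- rewrite (bigD1 j) //= big1 => [|p /negPf pj].
    by rewrite ds /delta eqxx addr0 mul1r eq_sym.
  by rewrite {1}/delta eq_sym pj mul0r.
- rewrite (bigD1 j) //= big1 => [|p /negPf pj].
    by rewrite ds /delta eqxx addr0 mul1r.
  by rewrite ds {1}/delta pj mul0r.
Qed.

Definition teps : term C d -> C := @teval C^o Num.conj delta.

Lemma teps_teq t u : teq t u -> teps t = teps u.
Proof. exact: (teval_teq conj_star delta_orthogonal). Qed.

End TermEval.

Section Pol.
Variables (C : numClosedFieldType) (d : nat).

Definition teqb (t u : term C d) : bool := `[< teq t u >].

Lemma teqb_equiv : equiv_class_of teqb.
Proof.
split=> [t|t u|u t v].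
- by apply/asboolP; exact: teq_refl.
- by apply/asboolP/asboolP; exact: teq_sym.
- by move=> /asboolP tu /asboolP uv; apply/asboolP; exact: teq_trans tu uv.
Qed.

Canonical teqb_equivRel := EquivRelPack teqb_equiv.
Canonical teqb_encModRel := defaultEncModRel teqb.

Definition PolO : Type := {eq_quot teqb}.

HB.instance Definition _ : EqQuotient (term C d) teqb PolO :=
  EqQuotient.on PolO.
HB.instance Definition _ := Choice.on PolO.

Definition cls (t : term C d) : PolO := \pi t.

Lemma clsP t u : cls t = cls u <-> teq t u.
Proof. by split=> [/eqmodP/asboolP|tu] //; apply/eqmodP/asboolP. Qed.

Lemma cls_repr (a : PolO) : cls (repr a) = a. Proof. exact: reprK. Qed.

Lemma repr_cls t : teq (repr (cls t)) t.
Proof. by apply/clsP; rewrite cls_repr. Qed.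

Definition pzero : PolO := cls TZero.
Definition pone : PolO := cls TOne.
Definition padd (a b : PolO) : PolO := cls (TAdd (repr a) (repr b)).
Definition pscale (c : C) (a : PolO) : PolO := cls (TScale c (repr a)).
Definition popp (a : PolO) : PolO := pscale (-1) a.
Definition pmul (a b : PolO) : PolO := cls (TMul (repr a) (repr b)).

Definition star (a : PolO) : PolO := cls (TStar (repr a)).

Lemma clsD t u : cls (TAdd t u) = padd (cls t) (cls u).
Proof. by apply/clsP; apply: teq_sym; apply: teq_add; exact: repr_cls. Qed.
Lemma clsZ c t : cls (TScale c t) = pscale c (cls t).
Proof. by apply/clsP; apply: teq_sym; apply: teq_scale; exact: repr_cls. Qed.
Lemma clsM t u : cls (TMul t u) = pmul (cls t) (cls u).
Proof. by apply/clsP; apply: teq_sym; apply: teq_mul; exact: repr_cls. Qed.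
Lemma cls_star t : cls (TStar t) = star (cls t).
Proof. by apply/clsP; apply: teq_sym; apply: teq_star; exact: repr_cls. Qed.

Lemma clsW (P : PolO -> Prop) : (forall t, P (cls t)) -> forall a, P a.
Proof. by move=> Pt a; rewrite -[a]cls_repr. Qed.

Lemma paddA : associative padd.
Proof.
elim/clsW=> t; elim/clsW=> u; elim/clsW=> v.
by rewrite -!clsD; apply/clsP; exact: teq_addA.
Qed.
Lemma paddC : commutative padd.
Proof.
by elim/clsW=> t; elim/clsW=> u; rewrite -!clsD; apply/clsP; exact: teq_addC.
Qed.
Lemma padd0 : left_id pzero padd.
Proof. by elim/clsW=> t; rewrite -!clsD; apply/clsP; exact: teq_add0. Qed.
Lemma paddN : left_inverse pzero popp padd.
Proof.
by elim/clsW=> t; rewrite /popp -!clsZ -!clsD; apply/clsP; exact: teq_addN.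
Qed.

HB.instance Definition _ := GRing.isZmodule.Build PolO paddA paddC padd0 paddN.

Lemma pmulA : associative pmul.
Proof.
elim/clsW=> t; elim/clsW=> u; elim/clsW=> v.
by rewrite -!clsM; apply/clsP; exact: teq_mulA.
Qed.
Lemma pmul1p : left_id pone pmul.
Proof. by elim/clsW=> t; rewrite -!clsM; apply/clsP; exact: teq_mul1t. Qed.
Lemma pmulp1 : right_id pone pmul.
Proof. by elim/clsW=> t; rewrite -!clsM; apply/clsP; exact: teq_mult1. Qed.
Lemma pmulDl : left_distributive pmul +%R.
Proof.
elim/clsW=> t; elim/clsW=> u; elim/clsW=> v.
rewrite -[_ + _]clsD -!clsM -[RHS]clsD.
by apply/clsP; exact: teq_mulDl.
Qed.
Lemma pmulDr : right_distributive pmul +%R.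
Proof.
elim/clsW=> t; elim/clsW=> u; elim/clsW=> v.
rewrite -[_ + _]clsD -!clsM -[RHS]clsD.
by apply/clsP; exact: teq_mulDr.
Qed.
Lemma pone_neq0 : pone != 0.
Proof.
apply/eqP => /clsP/teps_teq/eqP; rewrite /teps /=.
by rewrite (oner_eq0 C).
Qed.

HB.instance Definition _ := GRing.Zmodule_isNzRing.Build PolO
  pmulA pmul1p pmulp1 pmulDl pmulDr pone_neq0.

Lemma pscaleA a b v : pscale a (pscale b v) = pscale (a * b) v.
Proof.
by elim/clsW: v => t; rewrite -!clsZ; apply/clsP; exact: teq_scaleA.
Qed.
Lemma pscale1 : left_id 1 pscale.
Proof. by elim/clsW=> t; rewrite -!clsZ; apply/clsP; exact: teq_scale1. Qed.
Lemma pscaleDr : right_distributive pscale +%R.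
Proof.
move=> c; elim/clsW=> t; elim/clsW=> u.
rewrite -[_ + _]clsD -!clsZ -[RHS]clsD.
by apply/clsP; exact: teq_scaleDr.
Qed.
Lemma pscaleDl v : {morph pscale^~ v : a b / a + b}.
Proof.
move=> a b; elim/clsW: v => t.
by rewrite -!clsZ -[RHS]clsD; apply/clsP; exact: teq_scaleDl.
Qed.

HB.instance Definition _ := GRing.Zmodule_isLmodule.Build C PolO
  pscaleA pscale1 pscaleDr pscaleDl.

Lemma pscaleAl (a : C) (u v : PolO) : a *: (u * v) = (a *: u) * v.
Proof.
elim/clsW: u => t; elim/clsW: v => u.
rewrite -[_ * _]clsM -[LHS]clsZ -[_ *: _]clsZ -[RHS]clsM.
by apply/clsP; exact: teq_scaleAl.
Qed.

HB.instance Definition _ := GRing.Lmodule_isLalgebra.Build C PolO pscaleAl.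

Lemma pscaleAr (a : C) (u v : PolO) : a *: (u * v) = u * (a *: v).
Proof.
elim/clsW: u => t; elim/clsW: v => u.
rewrite -[_ * _]clsM -[LHS]clsZ -[_ *: _]clsZ -[RHS]clsM.
by apply/clsP; exact: teq_scaleAr.
Qed.

HB.instance Definition _ := GRing.Lalgebra_isAlgebra.Build C PolO pscaleAr.

Lemma cls0E : cls TZero = 0. Proof. by []. Qed.
Lemma cls1E : cls TOne = 1. Proof. by []. Qed.
Lemma clsDE t u : cls (TAdd t u) = cls t + cls u. Proof. exact: clsD. Qed.
Lemma clsZE c t : cls (TScale c t) = c *: cls t. Proof. exact: clsZ. Qed.
Lemma clsME t u : cls (TMul t u) = cls t * cls u. Proof. exact: clsM. Qed.

Lemma star_is_star : is_star star.
Proof.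
split.
- by elim/clsW=> t; rewrite -!cls_star; apply/clsP; exact: teq_starK.
- elim/clsW=> t; elim/clsW=> u; rewrite -clsDE -!cls_star -clsDE.
  by apply/clsP; exact: teq_starD.
- move=> c; elim/clsW=> t; rewrite -clsZE -!cls_star -clsZE.
  by apply/clsP; exact: teq_starZ.
- elim/clsW=> t; elim/clsW=> u; rewrite -clsME -!cls_star -clsME.
  by apply/clsP; exact: teq_starM.
Qed.

Definition gen (j k : 'I_d) : PolO := cls (TGen j k).

Lemma gen_orthogonal : orthogonal_matrix star gen.
Proof.
have clsb (F : 'I_d -> term C d) :
    cls (\big[@TAdd C d/TZero]_(p < d) F p) = \sum_(p < d) cls (F p).
  exact: (big_morph cls clsDE cls0E).
have clsif (b : bool) : cls (if b then TOne else TZero) = b%:R by case: b.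
split=> j k.
- by rewrite /gen -cls_star; apply/clsP; exact: teq_gen_star.
- rewrite -clsif -((clsP _ _).2 (teq_unitaryl _ j k)).
  by rewrite clsb; apply: eq_bigr => p _; rewrite clsME cls_star.
- rewrite -clsif -((clsP _ _).2 (teq_unitaryr _ j k)).
  by rewrite clsb; apply: eq_bigr => p _; rewrite clsME cls_star.
Qed.

Lemma PolO_ind (P : PolO -> Prop) :
  (forall j k, P (gen j k)) -> P 0 -> P 1 ->
  (forall a b, P a -> P b -> P (a + b)) ->
  (forall c a, P a -> P (c *: a)) ->
  (forall a b, P a -> P b -> P (a * b)) ->
  (forall a, P a -> P (star a)) ->
  forall a, P a.
Proof.
move=> Pg P0 P1 PD PZ PM PS; apply: clsW; elim=> //.
- by move=> t Pt u Pu; rewrite clsDE; apply: PD.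
- by move=> c t Pt; rewrite clsZE; apply: PZ.
- by move=> t Pt u Pu; rewrite clsME; apply: PM.
- by move=> t Pt; rewrite cls_star; apply: PS.
Qed.

Theorem PolO_universal (B : algType C) (s : B -> B) (v : 'I_d -> 'I_d -> B) :
  is_star s -> orthogonal_matrix s v ->
  exists! f : PolO -> B,
    [/\ linear f, monoid_morphism f, {morph f : a / star a >-> s a}
      & forall j k, f (gen j k) = v j k].
Proof.
move=> hs hv; pose f (a : PolO) := teval s v (repr a).
have fE t : f (cls t) = teval s v t.
  by apply: teval_teq => //; exact: repr_cls.
exists f; split; [split|].
- move=> c; elim/clsW=> t; elim/clsW=> u.
  by rewrite -clsZE -clsDE !fE.
- split; first by rewrite -cls1E fE.
  by elim/clsW=> t; elim/clsW=> u; rewrite -clsME !fE.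
- by elim/clsW=> t; rewrite -cls_star !fE.
- by move=> j k; rewrite fE.
move=> g [glin [g1 gM] gs gv]; apply/funext; apply: clsW => t.
have g0 : g 0 = 0 by have := glin (-1) 0 0; rewrite scaler0 addr0 scaleN1r addNr.
rewrite fE; elim: t => //=.
- by move=> j k; rewrite -gv.
- by move=> t IHt u IHu; rewrite clsDE -[cls t]scale1r glin scale1r IHt IHu.
- by move=> c t IHt; rewrite clsZE -[_ *: cls _]addr0 glin g0 addr0 IHt.
- by move=> t IHt u IHu; rewrite clsME gM IHt IHu.
- by move=> t IHt; rewrite cls_star gs IHt.
Qed.

Definition eps (a : PolO) : C^o := teps (repr a).

Lemma eps_cls t : eps (cls t) = teps t.
Proof. by apply: teps_teq; exact: repr_cls. Qed.

Lemma eps_linear : linear eps.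
Proof.
by move=> c; elim/clsW=> t; elim/clsW=> u; rewrite -clsZE -clsDE !eps_cls.
Qed.
Lemma eps_monoid_morphism : monoid_morphism eps.
Proof.
split; first by rewrite -cls1E eps_cls.
by elim/clsW=> t; elim/clsW=> u; rewrite -clsME !eps_cls.
Qed.

HB.instance Definition _ := GRing.isLinear.Build C PolO C^o *:%R eps eps_linear.
HB.instance Definition _ :=
  GRing.isMonoidMorphism.Build PolO C^o eps eps_monoid_morphism.

Lemma eps_star a : eps (star a) = (eps a)^*.
Proof. by elim/clsW: a => t; rewrite -cls_star !eps_cls. Qed.

Lemma eps_gen j k : eps (gen j k) = (j == k)%:R.
Proof. exact: eps_cls. Qed.

Definition gaussian (eta : PolO -> C^o) :=
  linear eta /\ forall a b, eta (a * b) = eps a * eta b + eta a * eps b.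

(* The value of eta_V on a term.  If eta is Gaussian with matrix V, then
   a |-> conj (eta (a^* )) is Gaussian with the conjugate matrix, whence the
   last clause. *)
Fixpoint tgauss (V : 'M[C]_d) (t : term C d) : C :=
  match t with
  | TGen j k => V j k
  | TZero => 0
  | TOne => 0
  | TAdd t u => tgauss V t + tgauss V u
  | TScale c t => c * tgauss V t
  | TMul t u => teps t * tgauss V u + tgauss V t * teps u
  | TStar t => (tgauss (map_mx Num.conj V) t)^*
  end.

(* eta_V; meaningful only for V^T = - V, see gaussP *)
Definition gauss (V : 'M[C]_d) (a : PolO) : C^o := tgauss V (repr a).

Lemma tgauss_teq V t u : V^T = - V -> teq t u -> tgauss V t = tgauss V u.
Proof.
move=> hV tu; elim: tu V hV => {t u}.
- by [].
- by move=> t u _ IH V hV; rewrite IH.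
- by move=> t u v _ IH1 _ IH2 V hV; rewrite IH1 // IH2.
- by move=> t t' u u' _ IH1 _ IH2 V hV /=; rewrite IH1 // IH2.
- by move=> c t t' _ IH V hV /=; rewrite IH.
- move=> t t' u u' tt' IH1 uu' IH2 V hV /=.
  by rewrite IH1 // IH2 // (teps_teq tt') (teps_teq uu').
- move=> t t' _ IH V hV /=; rewrite IH //.
  apply/matrixP => i j; have /matrixP/(_ i j) := hV.
  by rewrite !mxE => ->; rewrite rmorphN.
- by move=> t u v V hV /=; rewrite addrA.
- by move=> t u V hV /=; rewrite addrC.
- by move=> t V hV /=; rewrite add0r.
- by move=> t V hV /=; rewrite mulN1r addNr.
- by move=> a b t V hV /=; rewrite mulrA.
- by move=> t V hV /=; rewrite mul1r.
- by move=> a t u V hV /=; rewrite mulrDr.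
- by move=> a b t V hV /=; rewrite mulrDl.
- move=> t u v V hV /=; rewrite /teps /= -/(teps t) -/(teps u) -/(teps v).
  by rewrite mulrDr mulrDl !mulrA addrA.
- by move=> t V hV /=; rewrite mul0r addr0 /teps /= mul1r.
- by move=> t V hV /=; rewrite mulr0 add0r /teps /= mulr1.
- move=> t u v V hV /=; rewrite /teps /= -/(teps t) -/(teps u) -/(teps v).
  by rewrite !mulrDl addrACA.
- move=> t u v V hV /=; rewrite /teps /= -/(teps t) -/(teps u) -/(teps v).
  by rewrite !mulrDr addrACA.
- move=> a t u V hV /=; rewrite /teps /= -/(teps t) -/(teps u).
  by rewrite mulrDr !mulrA.
- move=> a t u V hV /=; rewrite /teps /= -/(teps t) -/(teps u).
  by rewrite mulrDr mulrCA [a * (_ * teps u)]mulrCA.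
- move=> t V hV /=; rewrite conjCK; congr tgauss.
  by apply/matrixP => i j; rewrite !mxE conjCK.
- by move=> t u V hV /=; rewrite rmorphD.
- by move=> a t V hV /=; rewrite rmorphM.
- move=> t u V hV /=; rewrite /teps /= -/(teps t) -/(teps u).
  by rewrite rmorphD !rmorphM addrC mulrC [X in _ + X]mulrC.
- by move=> j k V hV /=; rewrite mxE conjCK.
- move=> j k V hV.
  rewrite (big_morph (tgauss V) (fun _ _ => erefl) erefl) /=.
  under eq_bigr do rewrite mxE conjCK /teps /= /delta conjC_nat.
  rewrite big_split /= (bigD1 j) //= big1 ?addr0 => [|p /negPf pj]; last first.
    by rewrite eq_sym pj mul0r.
  rewrite (bigD1 k) //= big1 ?addr0 => [|p /negPf pk]; last first.
    by rewrite [k == p]eq_sym pk mulr0.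
  rewrite !eqxx mul1r mulr1.
  have /matrixP/(_ j k) := hV; rewrite !mxE => ->.
  by rewrite addNr; case: eqP.
- move=> j k V hV.
  rewrite (big_morph (tgauss V) (fun _ _ => erefl) erefl) /=.
  under eq_bigr do rewrite mxE conjCK /teps /= /delta conjC_nat.
  rewrite big_split /= (bigD1 j) //= big1 ?addr0 => [|p /negPf pj]; last first.
    by rewrite pj mul0r.
  rewrite (bigD1 k) //= big1 ?addr0 => [|p /negPf pk]; last first.
    by rewrite pk mulr0.
  rewrite !eqxx mul1r mulr1.
  have /matrixP/(_ j k) := hV; rewrite !mxE => ->.
  by rewrite subrr; case: eqP.
Qed.

Lemma gauss_cls V t : V^T = - V -> gauss V (cls t) = tgauss V t.
Proof. by move=> hV; apply: tgauss_teq => //; exact: repr_cls. Qed.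

Lemma gaussP V : V^T = - V ->
  gaussian (gauss V) /\ forall j k, gauss V (gen j k) = V j k.
Proof.
move=> hV; split; [split|].
- move=> c; elim/clsW=> t; elim/clsW=> u.
  by rewrite -clsZE -clsDE !gauss_cls.
- elim/clsW=> t; elim/clsW=> u.
  by rewrite -clsME !gauss_cls // !eps_cls.
- by move=> j k; rewrite gauss_cls.
Qed.

Lemma gaussian0 eta : gaussian eta -> eta 0 = 0.
Proof.
by case=> lin _; have := lin (-1) 0 0; rewrite scaler0 addr0 scaleN1r addNr.
Qed.

Lemma gaussian_star eta :
  gaussian eta -> gaussian (fun a => (eta (star a))^* : C^o).
Proof.
have [sK sD sZ sM] := star_is_star.
move=> [lin der]; split=> [c a b|a b].
- by rewrite sD sZ lin rmorphD /= [X in X + _]rmorphM /= conjCK.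
- rewrite sM der rmorphD !rmorphM /= !eps_star !conjCK.
  by rewrite addrC mulrC [X in _ + X]mulrC.
Qed.

Lemma gaussian_unique eta1 eta2 : gaussian eta1 -> gaussian eta2 ->
  (forall j k, eta1 (gen j k) = eta2 (gen j k)) -> eta1 =1 eta2.
Proof.
move=> g1 g2 hg; apply: clsW => t.
elim: t eta1 eta2 g1 g2 hg => [j k|||t IHt u IHu|c t IHt|t IHt u IHu|t IHt] e1 e2
  g1 g2 hg.
- exact: hg.
- by rewrite cls0E !gaussian0.
- have h e : gaussian e -> e 1 = 0.
    move=> [_ /(_ 1 1)]; rewrite rmorph1 !mulr1 mul1r.
    by move=> /(congr1 (fun z => z - e 1)); rewrite subrr addrK => <-.
  by rewrite cls1E !h.
- rewrite clsDE -[cls t]scale1r (proj1 g1) (proj1 g2).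
  by rewrite (IHt e1 e2) // (IHu e1 e2).
- rewrite clsZE -[_ *: cls _]addr0 (proj1 g1) (proj1 g2) (IHt e1 e2) //.
  by rewrite !gaussian0.
- by rewrite clsME (proj2 g1) (proj2 g2) (IHt e1 e2) // (IHu e1 e2).
- rewrite cls_star; apply: (can_inj (@conjCK C)).
  apply: (IHt _ _ (gaussian_star g1) (gaussian_star g2)) => j k /=.
  by have [-> _ _] := gen_orthogonal; rewrite hg.
Qed.

End Pol.

Section Hochschild.
Variables (C : numClosedFieldType) (A : algType C) (e : {lrmorphism A -> C^o}).

(* Linear maps on the tensor square of A are represented by bilinear maps
   A -> A -> C^o; bd1 and bd2 are the coboundary maps out of degrees 1 and 2
   for the bimodule C with both actions given by the character e. *)
Definition bd1 (psi : A -> C^o) : A -> A -> C^o := fun a b =>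
  e a * psi b - psi (a * b) + psi a * e b.

Definition bd2 (c : A -> A -> C^o) : A -> A -> A -> C^o := fun a1 a2 a3 =>
  e a1 * c a2 a3 - c (a1 * a2) a3 + c a1 (a2 * a3) - c a1 a2 * e a3.

Definition is_cocycle (c : A -> A -> C^o) : Prop :=
  [/\ forall b, linear (c^~ b), forall a, linear (c a)
    & forall a1 a2 a3, bd2 c a1 a2 a3 = 0].

Definition Z2_pred : {pred A -> A -> C^o} := [pred c | `[< is_cocycle c >]].

Record Z2 := MkZ2 { Z2_val :> A -> A -> C^o; _ : Z2_val \in Z2_pred }.

HB.instance Definition _ := [isSub for Z2_val].
HB.instance Definition _ := [Choice of Z2 by <:].

Lemma Z2_submod : subsemimod_closed Z2_pred.
Proof.
split; first split.
- apply/asboolP; split=> [b x a a'|a x b b'|a1 a2 a3] /=.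
  + by rewrite scaler0 addr0.
  + by rewrite scaler0 addr0.
  + by rewrite /bd2 /= mulr0 mul0r !subr0 addr0.
- move=> c c' /asboolP[l1 r1 b1] /asboolP[l2 r2 b2].
  have E a b : (c + c') a b = c a b + c' a b by [].
  apply/asboolP; split=> [b x a a'|a x b b'|a1 a2 a3].
  + by rewrite /= !E (l1 b) (l2 b) scalerDr addrACA.
  + by rewrite /= !E (r1 a) (r2 a) scalerDr addrACA.
  + have -> : bd2 (c + c') a1 a2 a3 = bd2 c a1 a2 a3 + bd2 c' a1 a2 a3.
      by rewrite /bd2 !E; ring.
    by rewrite b1 b2 addr0.
- move=> x c /asboolP[l1 r1 b1].
  have E a b : (x *: c) a b = x * c a b by [].
  apply/asboolP; split=> [b y a a'|a y b b'|a1 a2 a3].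
  + by rewrite /= !E (l1 b) mulrDr; congr (_ + _); exact: mulrCA.
  + by rewrite /= !E (r1 a) mulrDr; congr (_ + _); exact: mulrCA.
  + have -> : bd2 (x *: c) a1 a2 a3 = x * bd2 c a1 a2 a3.
      by rewrite /bd2 !E; ring.
    by rewrite b1 mulr0.
Qed.

HB.instance Definition _ :=
  GRing.SubChoice_isSubLmodule.Build C (A -> A -> C^o) Z2_pred Z2 Z2_submod.

Definition is_coboundary (c : A -> A -> C^o) : Prop :=
  exists2 psi : A -> C^o, linear psi & forall a b, c a b = bd1 psi a b.

Definition B2 : Z2 -> bool := fun c => `[< is_coboundary c >].

Lemma B2_submod : subsemimod_closed B2.
Proof.
split; first split.
- apply/asboolP; exists (fun=> 0) => [x a b|a b].
  + by rewrite scaler0 addr0.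
  + by rewrite /bd1 mulr0 mul0r subr0 addr0.
- move=> c c' /asboolP[p lp cp] /asboolP[q lq cq]; apply/asboolP.
  exists (fun a => p a + q a) => [x a b|a b].
  + by rewrite lp lq scalerDr addrACA.
  + rewrite -[LHS]/(c a b + c' a b) cp cq /bd1; ring.
- move=> x c /asboolP[p lp cp]; apply/asboolP.
  exists (fun a => x * p a) => [y a b|a b].
  + by rewrite lp mulrDr; congr (_ + _); exact: mulrCA.
  + rewrite -[LHS]/(x * c a b) cp /bd1; ring.
Qed.

HB.instance Definition _ := GRing.isSubmodClosed.Build C Z2 B2 B2_submod.

Definition B2_zmod : zmodClosed Z2 := GRing.ZmodClosed.clone Z2 B2 _.

Definition H2 : Type := Quotient.quot B2_zmod.

HB.instance Definition _ := GRing.Zmodule.on H2.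
HB.instance Definition _ : EqQuotient Z2 (Quotient.equiv B2_zmod) H2 :=
  EqQuotient.on H2.

Definition H2class (c : Z2) : H2 := \pi c.

Lemma H2classP c c' : H2class c = H2class c' <-> is_coboundary (c - c').
Proof.
rewrite /H2class; split=> [/eqP|h].
- by rewrite -(Quotient.idealrBE B2_zmod) => /asboolP.
- by apply/eqP; rewrite -(Quotient.idealrBE B2_zmod); apply/asboolP.
Qed.

Definition H2scale (x : C) (h : H2) : H2 := H2class (x *: repr h).

Lemma H2classD : {morph H2class : c c' / c + c'}.
Proof. by move=> c c'; rewrite /H2class; exact: (Quotient.pi_add B2_zmod). Qed.

Lemma H2classZ x c : H2class (x *: c) = H2scale x (H2class c).
Proof.
apply/eqP; rewrite /H2scale /H2class -(Quotient.idealrBE B2_zmod) -scalerBr rpredZ //.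
by rewrite (Quotient.idealrBE B2_zmod) reprK.
Qed.

Lemma H2W (P : H2 -> Prop) : (forall c, P (H2class c)) -> forall h, P h.
Proof. by move=> Pc h; rewrite -[h]reprK. Qed.

Lemma H2scaleA a b h : H2scale a (H2scale b h) = H2scale (a * b) h.
Proof. by elim/H2W: h => c; rewrite -!H2classZ scalerA. Qed.
Lemma H2scale1 : left_id 1 H2scale.
Proof. by elim/H2W=> c; rewrite -H2classZ scale1r. Qed.
Lemma H2scaleDr : right_distributive H2scale +%R.
Proof.
move=> x; elim/H2W=> c; elim/H2W=> c'.
by rewrite -H2classD -!H2classZ -H2classD scalerDr.
Qed.
Lemma H2scaleDl h : {morph H2scale^~ h : a b / a + b}.
Proof.
by move=> a b; elim/H2W: h => c; rewrite -!H2classZ -H2classD scalerDl.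
Qed.

HB.instance Definition _ := GRing.Zmodule_isLmodule.Build C H2
  H2scaleA H2scale1 H2scaleDr H2scaleDl.

Lemma H2class_linear : linear H2class.
Proof. by move=> x c c'; rewrite H2classD H2classZ. Qed.

HB.instance Definition _ :=
  GRing.isLinear.Build C Z2 H2 *:%R H2class H2class_linear.

End Hochschild.

Section Khat.
Variables (C : numClosedFieldType) (d : nat).
Implicit Types eta : PolO C d -> C^o.

Definition K eta1 eta2 : PolO C d -> PolO C d -> C^o := fun a b =>
  (eta1 (star a))^* * eta2 b.

Lemma K_cocycle eta1 eta2 : gaussian eta1 -> gaussian eta2 ->
  K eta1 eta2 \in Z2_pred (@eps C d).
Proof.
move=> /gaussian_star; pose f a : C^o := (eta1 (star a))^*.
rewrite -/f; have KE a b : K eta1 eta2 a b = f a * eta2 b by [].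
move: f KE => f KE [lf df] [lg dg].
apply/asboolP; split=> [b x a a'|a x b b'|a1 a2 a3] /=; rewrite /bd2 ?KE.
- by rewrite lf mulrDl; congr (_ + _); exact/esym/mulrA.
- by rewrite lg mulrDr; congr (_ + _); exact: mulrCA.
- rewrite df dg; ring.
Qed.

Definition Zmx (j k : 'I_d) : 'M[C]_d := delta_mx j k - delta_mx k j.

Lemma Zmx_skew j k : (Zmx j k)^T = - Zmx j k.
Proof. by rewrite /Zmx linearB /= !trmx_delta opprB. Qed.

(* Khat m n for the auxiliary index l *)
Definition Khat (l m n : 'I_d) : Z2 (@eps C d) :=
  MkZ2 (K_cocycle (proj1 (gaussP (Zmx_skew l m)))
                  (proj1 (gaussP (Zmx_skew l n)))).

End Khat.

Definition is_basis (F : fieldType) (V : lmodType F) (I : finType)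
    (v : I -> V) : Prop :=
  (forall a : I -> F, \sum_i a i *: v i = 0 -> forall i, a i = 0) /\
  (forall x : V, exists a : I -> F, x = \sum_i a i *: v i).

(* Main.v *)
Require Import Defs.
From HB Require Import structures.
From mathcomp Require Import all_boot all_order all_algebra.
From mathcomp Require Import boolp reals complex ring.

(* A 2-cocycle c is the coboundary of psi iff the matrix x = psi(u) solves the
   relations of Pol(O_d^+) twisted by c.  Both unitarity relations reduce to
   x + x^t = D + c(1, 1), where D_jk = sum_p c(u_jp, u_kp), because evaluating
   u u^t u in two ways gives sum_p c(u_pj, u_pk) = D_jk.  So c is a coboundary iff D
   is symmetric, and the entries of D - D^t above the diagonal are coordinates on
   H^2.  The matrix D of Khat_{m,n} is the matrix unit e_mn.  For d = 2 products of
   Gaussian cocycles have symmetric D; a cocycle with D = e_mn, for any d, is a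
   product of derivations twisted by the character u |-> -1. *)

Set Implicit Arguments.
Unset Strict Implicit.
Unset Printing Implicit Defensive.

Import Order.TTheory GRing.Theory Num.Theory.

Local Open Scope ring_scope.

(** * Linear functionals given as bare functions *)

Section LinearFunctional.
Variables (C : numClosedFieldType) (V : lmodType C) (f : V -> C^o).
Hypothesis flin : linear f.

Let fL : {linear V -> C^o} := HB.pack f (GRing.isLinear.Build C V C^o *:%R f flin).

Lemma linD : {morph f : a b / a + b}.
Proof. exact: (linearD fL). Qed.

Lemma linZ z a : f (z *: a) = z * f a.
Proof. exact: (linearZ_LR fL). Qed.

Lemma lin_sum (I : finType) (F : I -> V) : f (\sum_i F i) = \sum_i f (F i).
Proof. exact: (linear_sum fL). Qed.

End LinearFunctional.

(** * Primitives of 2-cocycles, with characters [l] and [r] acting on the two sides *)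

Section Primitive.
Variables (C : numClosedFieldType) (d : nat).
Local Notation A := (PolO C d).
Variables (l r : A -> C^o) (c : A -> A -> C^o) (x : 'I_d -> 'I_d -> C).
Hypotheses (llin : linear l) (lmor : monoid_morphism l).
Hypotheses (rlin : linear r) (rmor : monoid_morphism r).
Hypotheses (clinl : forall b, linear (c^~ b)) (clinr : forall a, linear (c a)).
Hypothesis ccocycle : forall a1 a2 a3,
  l a1 * c a2 a3 - c (a1 * a2) a3 + c a1 (a2 * a3) - c a1 a2 * r a3 = 0.
(** What a primitive with values [x] on the generators must satisfy on the unitarity relations; its
    value at 1 is forced to be [c 1 1]. *)
Hypothesis x_unitaryl : forall j k,
  \sum_p (l (gen C j p) * x k p + x j p * r (gen C k p)
          - c (gen C j p) (gen C k p)) = (j == k)%:R * c 1 1.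
Hypothesis x_unitaryr : forall j k,
  \sum_p (l (gen C p j) * x p k + x p j * r (gen C p k)
          - c (gen C p j) (gen C p k)) = (j == k)%:R * c 1 1.

Let star_if (b : bool) (a : A) := if b then star a else a.

(** The value forced at [a * b] on a primitive taking the values [y] at [a] and [z] at [b]. *)
Let mul_prim (a b : A) (y z : C) : C := l a * z + y * r b - c a b.

(* The value of a primitive of c on t if b = false, and on t^* if b = true; the
   second case is needed because c is not assumed to be compatible with star. *)
Fixpoint tprim (b : bool) (t : term C d) : C :=
  match t with
  | TGen j k => x j k
  | TZero => 0
  | TOne => c 1 1
  | TAdd t u => tprim b t + tprim b u
  | TScale z t => (if b then z^* else z) * tprim b t
  | TMul t u =>
      if b then mul_prim (star (cls u)) (star (cls t)) (tprim b u) (tprim b t)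
      else mul_prim (cls t) (cls u) (tprim b t) (tprim b u)
  | TStar t => tprim (~~ b) t
  end.

Let c1a a : c 1 a = c 1 1 * r a.
Proof.
have := ccocycle 1 1 a; rewrite !mul1r lmor.1 mul1r => /eqP.
by rewrite subrr add0r subr_eq0 => /eqP.
Qed.

Let ca1 a : c a 1 = l a * c 1 1.
Proof.
have := ccocycle a 1 1; rewrite !mulr1 rmor.1 mulr1 => /eqP.
by rewrite subrK subr_eq0 => /eqP.
Qed.

(** The two sides differ by the cocycle identity at [(a1, a2, a3)]. *)
Let mul_primA a1 a2 a3 y1 y2 y3 :
  mul_prim a1 (a2 * a3) y1 (mul_prim a2 a3 y2 y3) =
  mul_prim (a1 * a2) a3 (mul_prim a1 a2 y1 y2) y3.
Proof.
apply/eqP; rewrite -subr_eq0 /mul_prim lmor.2 rmor.2.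
rewrite -[X in _ == X]oppr0 -(ccocycle a1 a2 a3); apply/eqP; ring.
Qed.

Let mul_primDl a a' b y y' z :
  mul_prim (a + a') b (y + y') z = mul_prim a b y z + mul_prim a' b y' z.
Proof. rewrite /mul_prim (linD llin) (linD (clinl b)); ring. Qed.

Let mul_primDr a b b' y z z' :
  mul_prim a (b + b') y (z + z') = mul_prim a b y z + mul_prim a b' y z'.
Proof. rewrite /mul_prim (linD rlin) (linD (clinr a)); ring. Qed.

Let mul_primZl w a b y z :
  mul_prim (w *: a) b (w * y) z = w * mul_prim a b y z.
Proof. rewrite /mul_prim (linZ llin) (linZ (clinl b)); ring. Qed.

Let mul_primZr w a b y z :
  mul_prim a (w *: b) y (w * z) = w * mul_prim a b y z.
Proof. rewrite /mul_prim (linZ rlin) (linZ (clinr a)); ring. Qed.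

Let mul_prim1l a y : mul_prim 1 a (c 1 1) y = y.
Proof. by rewrite /mul_prim (c1a a) lmor.1 mul1r addrK. Qed.

Let mul_prim1r a y : mul_prim a 1 y (c 1 1) = y.
Proof. by rewrite /mul_prim (ca1 a) rmor.1 mulr1 addrC addKr. Qed.

Lemma tprim_teq t u : teq t u -> forall b, tprim b t = tprim b u.
Proof.
have [sK sD sZ sM] := @star_is_star C d.
have [sg _ _] := @gen_orthogonal C d.
have s1 : star 1 = 1 :> A by rewrite -[LHS]mulr1 -{2}[1]sK -sM mulr1 sK.
have sumE b (F : 'I_d -> term C d) :
    tprim b (\big[@TAdd C d/TZero]_(p < d) F p) = \sum_(p < d) tprim b (F p).
  exact: (big_morph (tprim b) (fun=> fun=> erefl) erefl).
have ifE b (e : bool) : tprim b (if e then TOne else TZero) = e%:R * c 1 1.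
  by case: e; rewrite /= ?mul1r ?mul0r.
elim=> {t u}.
- by [].
- by move=> t u _ IH b; rewrite IH.
- by move=> t u v _ IH1 _ IH2 b; rewrite IH1.
- by move=> t t' u u' _ IH1 _ IH2 b /=; rewrite IH1 IH2.
- by move=> z t t' _ IH b /=; rewrite IH.
- move=> t t' u u' /clsP tt' IH1 /clsP uu' IH2 b /=.
  by rewrite IH1 IH2 tt' uu'.
- by move=> t t' _ IH b /=; rewrite IH.
- by move=> t u v b /=; rewrite addrA.
- by move=> t u b /=; rewrite addrC.
- by move=> t b /=; rewrite add0r.
- by move=> t [] /=; rewrite ?rmorphN1 mulN1r addNr.
- by move=> y z t [] /=; rewrite ?rmorphM /= mulrA.
- by move=> t [] /=; rewrite ?rmorph1 mul1r.
- by move=> z t u b /=; rewrite mulrDr.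
- by move=> y z t [] /=; rewrite ?rmorphD /= mulrDl.
- by move=> t u v [] /=; rewrite !clsME ?sM mul_primA.
- by move=> t [] /=; rewrite cls1E ?s1 ?mul_prim1l ?mul_prim1r.
- by move=> t [] /=; rewrite cls1E ?s1 ?mul_prim1l ?mul_prim1r.
- by move=> t u v [] /=; rewrite !clsDE ?sD ?mul_primDl ?mul_primDr.
- by move=> t u v [] /=; rewrite !clsDE ?sD ?mul_primDl ?mul_primDr.
- by move=> z t u [] /=; rewrite !clsZE ?sZ ?mul_primZl ?mul_primZr.
- by move=> z t u [] /=; rewrite !clsZE ?sZ ?mul_primZl ?mul_primZr.
- by move=> t b /=; rewrite negbK.
- by [].
- by move=> z t [] /=; rewrite ?conjCK.
- by move=> t u [] /=; rewrite !cls_star ?sK.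
- by move=> j k [].
- move=> j k b; rewrite sumE ifE; case: b => /=.
  (* The star reverses products, so this is the relation with [j] and [k] exchanged. *)
  + rewrite eq_sym -x_unitaryl; apply: eq_bigr => p _.
    by rewrite cls_star -!/(gen _ _ _) sK sg.
  + rewrite -x_unitaryl; apply: eq_bigr => p _.
    by rewrite cls_star -!/(gen _ _ _) sg.
- move=> j k b; rewrite sumE ifE; case: b => /=.
  + rewrite eq_sym -x_unitaryr; apply: eq_bigr => p _.
    by rewrite cls_star -!/(gen _ _ _) sK sg.
  + rewrite -x_unitaryr; apply: eq_bigr => p _.
    by rewrite cls_star -!/(gen _ _ _) sg.
Qed.

(** By [tprim_teq] the recursion on terms descends to the quotient. Taking [l = r = eps] serves the
    coboundary criterion; [c = 0] with distinct characters gives twisted derivations. *)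
Lemma exists_primitive : exists psi : A -> C^o,
  [/\ linear psi,
      forall a b, psi (a * b) = l a * psi b + psi a * r b - c a b
    & forall j k, psi (gen C j k) = x j k].
Proof.
pose psi (a : A) : C^o := tprim false (repr a).
have psiE t : psi (cls t) = tprim false t.
  by apply: tprim_teq; exact: repr_cls.
exists psi; split.
- move=> z; elim/clsW=> t; elim/clsW=> u.
  by rewrite -clsZE -clsDE !psiE.
- by elim/clsW=> t; elim/clsW=> u; rewrite -clsME !psiE.
- by move=> j k; rewrite psiE.
Qed.

End Primitive.

(** * The defect matrix and the coboundary criterion *)

Section Defect.
Variables (C : numClosedFieldType) (d : nat).
Local Notation A := (PolO C d).

Lemma sum_gen_row j k : \sum_p gen C j p * gen C k p = (j == k)%:R :> A.
Proof.
have [sg ul _] := @gen_orthogonal C d.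
by rewrite -ul; apply: eq_bigr => p _; rewrite sg.
Qed.

Lemma sum_gen_col j k : \sum_p gen C p j * gen C p k = (j == k)%:R :> A.
Proof.
have [sg _ ur] := @gen_orthogonal C d.
by rewrite -ur; apply: eq_bigr => p _; rewrite sg.
Qed.

Lemma sum_deltal (F : 'I_d -> C) j : \sum_p (j == p)%:R * F p = F j.
Proof.
rewrite (bigD1 j) //= eqxx mul1r big1 ?addr0 // => p /negPf pj.
by rewrite eq_sym pj mul0r.
Qed.

Lemma sum_deltar (F : 'I_d -> C) j : \sum_p F p * (j == p)%:R = F j.
Proof. by under eq_bigr do rewrite mulrC; exact: sum_deltal. Qed.

(** The matrix $D$ of the introduction. *)
Definition defect (c : A -> A -> C^o) (j k : 'I_d) : C :=
  \sum_p c (gen C j p) (gen C k p).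

Section Cocycle.
Variable c : A -> A -> C^o.
Hypothesis hc : is_cocycle (@eps C d) c.

Lemma cocycle1l a : c 1 a = c 1 1 * eps a.
Proof.
have [_ _ bd] := hc; have := bd 1 1 a.
rewrite /bd2 !mul1r rmorph1 mul1r => /eqP.
by rewrite subrr add0r subr_eq0 => /eqP.
Qed.

Lemma cocycle1r a : c a 1 = eps a * c 1 1.
Proof.
have [_ _ bd] := hc; have := bd a 1 1.
rewrite /bd2 !mulr1 rmorph1 mulr1 => /eqP.
by rewrite subrK subr_eq0 => /eqP.
Qed.

(* Sum the cocycle identity over p, q at (u_jp, u_qp, u_qk), that is, compare
   the two ways of evaluating u u^t u. *)
Lemma defect_col j k : \sum_p c (gen C p j) (gen C p k) = defect c j k.
Proof.
have [lc rc bd] := hc.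
have : \sum_p \sum_q bd2 (@eps C d) c (gen C j p) (gen C q p) (gen C q k) = 0.
  by rewrite big1 // => p _; rewrite big1.
rewrite /bd2.
under eq_bigr do rewrite sumrB big_split sumrB /=.
rewrite sumrB big_split sumrB /=.
under eq_bigr do under eq_bigr do rewrite eps_gen.
under eq_bigr do rewrite -mulr_sumr.
rewrite sum_deltal exchange_big /=.
under [X in _ - X + _ - _]eq_bigr do rewrite -(lin_sum (lc _)) sum_gen_row.
have cb (b : bool) a : c b%:R a = b%:R * c 1 a.
  by rewrite -(linZ (lc a)) scaler_nat.
have cb' (b : bool) a : c a b%:R = b%:R * c a 1.
  by rewrite -(linZ (rc a)) scaler_nat.
under [X in _ - X + _ - _]eq_bigr do rewrite cb.
rewrite sum_deltal.
under [X in _ + X - _]eq_bigr do rewrite -(lin_sum (rc _)) sum_gen_col cb' eq_sym.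
(* The two middle terms have become [c 1 (gen C j k)] and [c (gen C j k) 1], which are equal and
   cancel. *)
rewrite sum_deltal (cocycle1l (gen C j k)) (cocycle1r (gen C j k)) [c 1 1 * _]mulrC subrK.
under [X in _ - X = _]eq_bigr do under eq_bigr do rewrite eps_gen eq_sym.
under [X in _ - X = _]eq_bigr do rewrite sum_deltar.
by move/eqP; rewrite subr_eq0 => /eqP.
Qed.

Lemma coboundary_defect : is_coboundary (@eps C d) c <->
  forall j k, defect c j k = defect c k j.
Proof.
have [lc rc bd] := hc; split.
  move=> [psi lpsi cE] j k.
  (* Summing [bd1 psi] over a row relation gives $x + x^t - \psi(1) I$, which is visibly
     symmetric. *)
  have sE i i' : defect c i i' =
      psi (gen C i' i) + psi (gen C i i') - (i == i')%:R * psi 1.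
    rewrite /defect; under eq_bigr do rewrite cE /bd1 /= !eps_gen.
    rewrite big_split sumrB sum_deltal sum_deltar -(lin_sum lpsi) sum_gen_row.
    by rewrite -(linZ lpsi) scaler_nat addrAC.
  by rewrite !sE eq_sym [X in X - _]addrC.
move=> sym.
(* The symmetric solution of $x + x^t = D + c(1,1) I$. *)
pose x j k : C := (defect c j k + (j == k)%:R * c 1 1) / 2.
have xD j k : x k j + x j k = defect c j k + (j == k)%:R * c 1 1.
  by rewrite /x sym [k == j]eq_sym -mulrDl -mulr2n -[_ *+ 2]mulr_natr mulfK ?pnatr_eq0.
have [||psi [lpsi psiM _]] := @exists_primitive C d (@eps C d) (@eps C d) c x
  (@eps_linear C d) (@eps_monoid_morphism C d)
  (@eps_linear C d) (@eps_monoid_morphism C d) lc rc bd.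
- move=> j k; under eq_bigr do rewrite !eps_gen.
  by rewrite sumrB big_split sum_deltal sum_deltar -/(defect c j k) /= xD addrC addKr.
(* By [defect_col] the column relation is the same equation. *)
- move=> j k.
  under eq_bigr => p _ do rewrite !eps_gen [p == j]eq_sym [p == k]eq_sym.
  rewrite sumrB big_split sum_deltal sum_deltar defect_col /=.
  by rewrite [x j k + _]addrC xD addrC addKr.
exists psi => // a b; rewrite /bd1 psiM; ring.
Qed.

End Cocycle.

(** The matrix $-I$ is also orthogonal, so the universal property applies to it. *)
Lemma exists_sign_character : exists chi : A -> C^o,
  [/\ linear chi, monoid_morphism chi
    & forall j k, chi (gen C j k) = - (j == k)%:R].
Proof.
have [ds dl dr] := @delta_orthogonal C d.
have [|chi [[chilin chimor _ chigen] _]] :=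
    @PolO_universal C d C^o Num.conj (fun j k => - delta C j k) (@conj_star C).
  split=> j k; first by rewrite rmorphN /= ds.
  - by rewrite -dl; apply: eq_bigr => p _; rewrite rmorphN mulrNN.
  - by rewrite -dr; apply: eq_bigr => p _; rewrite rmorphN mulrNN.
by exists chi.
Qed.

(* Twisted by the character chi with chi(u) = -1, derivations are given by
   symmetric instead of skew-symmetric matrices; the cup product of two of them
   is an untwisted cocycle. *)
Lemma exists_cocycle_defect (X Y : 'M[C]_d) : X^T = X -> Y^T = Y ->
  exists c : Z2 (@eps C d), forall j k, defect c j k = (X *m Y) j k.
Proof.
move=> Xs Ys; have [chi [chilin chimor chigen]] := exists_sign_character.
pose z (a b : A) : C^o := 0.
have zl b : linear (z^~ b) by move=> w a1 a2 /=; rewrite /z scaler0 addr0.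
have zr a : linear (z a) by move=> w a1 a2 /=; rewrite /z scaler0 addr0.
have symE (M : 'M[C]_d) : M^T = M -> forall j k, M j k = M k j.
  by move=> Ms j k; rewrite -{1}Ms mxE.
(* A primitive of 0 is a derivation. With [eps] on the left and [chi] on the right, both unitarity
   relations only ask that [X] be symmetric. *)
have [|||f [flin fM fgen]] := @exists_primitive C d (@eps C d) chi z X
  (@eps_linear C d) (@eps_monoid_morphism C d) chilin chimor zl zr.
- by move=> *; rewrite /z; ring.
- move=> j k; rewrite /z mulr0.
  under eq_bigr do rewrite subr0 eps_gen chigen mulrN.
  by rewrite sumrB sum_deltal sum_deltar (symE X) // subrr.
- move=> j k; rewrite /z mulr0.
  under eq_bigr => p _ do rewrite subr0 eps_gen chigen mulrN [p == j]eq_sym [p == k]eq_sym.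
  by rewrite sumrB sum_deltal sum_deltar (symE X) // subrr.
(* The characters are exchanged, so that the terms [f a1 * chi a2 * g a3] cancel in [bd2] of the
   product of [f] and [g]. *)
have [|||g [glin gM ggen]] := @exists_primitive C d chi (@eps C d) z Y
  chilin chimor (@eps_linear C d) (@eps_monoid_morphism C d) zl zr.
- by move=> *; rewrite /z; ring.
- move=> j k; rewrite /z mulr0.
  under eq_bigr do rewrite subr0 eps_gen chigen mulNr [- _ + _]addrC.
  by rewrite sumrB sum_deltal sum_deltar (symE Y) // subrr.
- move=> j k; rewrite /z mulr0.
  under eq_bigr => p _ do rewrite subr0 eps_gen chigen mulNr [- _ + _]addrC [p == j]eq_sym [p == k]eq_sym.
  by rewrite sumrB sum_deltal sum_deltar (symE Y) // subrr.
have hc : (fun a b => f a * g b : C^o) \in Z2_pred (@eps C d).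
  apply/asboolP; split=> [b w a a'|a w b b'|a1 a2 a3] /=.
  - by rewrite flin mulrDl; congr (_ + _); exact/esym/mulrA.
  - by rewrite glin mulrDr; congr (_ + _); exact: mulrCA.
  - rewrite /bd2 fM gM /z; ring.
exists (MkZ2 hc) => j k; rewrite /defect /= mxE.
by apply: eq_bigr => p _; rewrite fgen ggen (symE Y).
Qed.

End Defect.

(** * Bases from separating coordinates and a dual family *)

Section DualFamily.
Variables (F : fieldType) (V : lmodType F) (I : finType).
Variables (coord : I -> V -> F) (v : I -> V).
Hypothesis coord_linear : forall i (a : F) x y,
  coord i (a *: x + y) = a * coord i x + coord i y.
Hypothesis coord_inj : forall x, (forall i, coord i x = 0) -> x = 0.
Hypothesis coord_dual : forall i j, coord i (v j) = (i == j)%:R.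

Let coord0 i : coord i 0 = 0.
Proof.
by have := coord_linear i (-1) 0 0; rewrite scaler0 addr0 mulN1r addNr.
Qed.

Lemma coord_sum (a : I -> F) i : coord i (\sum_j a j *: v j) = a i.
Proof.
have coordD x y : coord i (x + y) = coord i x + coord i y.
  by have := coord_linear i 1 x y; rewrite scale1r mul1r.
rewrite (big_morph _ coordD (coord0 i)) (bigD1 i) //= big1 => [|j /negPf ji].
  by rewrite addr0 -[_ *: _]addr0 coord_linear coord0 coord_dual eqxx mulr1 addr0.
by rewrite -[_ *: _]addr0 coord_linear coord0 coord_dual eq_sym ji mulr0 addr0.
Qed.

Lemma coord_expansion x : x = \sum_i coord i x *: v i.
Proof.
apply/eqP; rewrite -subr_eq0; apply/eqP; apply: coord_inj => i.
by rewrite addrC -scaleN1r coord_linear coord_sum mulN1r addNr.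
Qed.

Lemma dual_is_basis : is_basis v.
Proof.
split=> [a a0 i|x]; first by rewrite -(coord_sum a) a0 coord0.
by exists (coord^~ x); exact: coord_expansion.
Qed.

Lemma dual_linear_bijection (n : nat) : #|I| = n ->
  exists f : {linear V -> 'rV[F]_n}, bijective f.
Proof.
(* Replacing [n] by [#|I|] lets [enum_val] and [enum_rank] index the row vectors. *)
move=> cardI; case: n / cardI.
pose f (x : V) : 'rV[F]_#|I| := \row_k coord (enum_val k) x.
have flin : linear f.
  by move=> a x y; apply/rowP => k; rewrite !mxE coord_linear.
pose fL : {linear V -> 'rV[F]_#|I|} :=
  HB.pack f (GRing.isLinear.Build F V 'rV[F]_#|I| *:%R f flin).
exists fL; exists (fun r : 'rV[F]_#|I| => \sum_i r 0 (enum_rank i) *: v i) => [x|r].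
  rewrite [RHS]coord_expansion; apply: eq_bigr => i _.
  by rewrite mxE enum_rankK.
by apply/rowP => k; rewrite mxE coord_sum enum_valK.
Qed.

End DualFamily.

(** For each larger index [j] there are [j] smaller ones, and these numbers sum to the binomial
    coefficient of [d] over 2. *)
Lemma card_ltn_pairs d :
  #|{: {p : 'I_d * 'I_d | (p.1 < p.2)%N}}| = (d * (d - 1) %/ 2)%N.
Proof.
rewrite card_sig divn2 subn1 -bin2 -bin2_sum big_mkord -sum1_card.
rewrite -(pair_big_dep xpredT (fun i j : 'I_d => (i < j)%N) (fun _ _ => 1%N)) /=.
rewrite (exchange_big_dep xpredT) //=; apply: eq_bigr => j _.
by rewrite -(big_ord_widen _ (fun=> 1%N)) 1?ltnW // sum1_card card_ord.
Qed.

(** * Coordinates on $H^2$ and cocycles dual to them *)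

Section Coordinates.
Variables (C : numClosedFieldType) (d : nat).
Local Notation H := (H2 (@eps C d)).
Local Notation pairs := {p : 'I_d * 'I_d | (p.1 < p.2)%N}.

Lemma Z2_cocycle (c : Z2 (@eps C d)) : is_cocycle (@eps C d) c.
Proof. by case: c => c /= /asboolP. Qed.

(** An entry of $D - D^t$ above the diagonal, read off a chosen representative; [skew_defect_class]
    removes the choice. *)
Definition skew_defect (p : pairs) (h : H) : C :=
  defect (repr h) (val p).1 (val p).2 - defect (repr h) (val p).2 (val p).1.

(** Two representatives differ by a coboundary, whose defect is symmetric. *)
Lemma skew_defect_class p c : skew_defect p (H2class c) =
  defect c (val p).1 (val p).2 - defect c (val p).2 (val p).1.
Proof.
rewrite /skew_defect; set c' := repr _.
have /H2classP/(coboundary_defect (Z2_cocycle (c' - c))) : H2class c' = H2class c.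
  exact: reprK.
move=> /(_ (val p).1 (val p).2).
have dB j k : defect (c' - c : Z2 _) j k = defect c' j k - defect c j k.
  by rewrite /defect -sumrB.
rewrite !dB => /eqP; rewrite -subr_eq0 => /eqP E.
apply/eqP; rewrite -subr_eq0 -[X in _ == X]E; apply/eqP; ring.
Qed.

Lemma skew_defect_linear p (a : C) x y :
  skew_defect p (a *: x + y) = a * skew_defect p x + skew_defect p y.
Proof.
elim/H2W: x => x; elim/H2W: y => y.
rewrite -[a *: _]H2classZ -H2classD !skew_defect_class.
have dD j k : defect (a *: x + y : Z2 _) j k = a * defect x j k + defect y j k.
  by rewrite /defect mulr_sumr -big_split.
rewrite !dD; ring.
Qed.

(** This is the converse half of [coboundary_defect]: a symmetric defect forces a coboundary. *)
Lemma skew_defect_inj x : (forall p, skew_defect p x = 0) -> x = 0.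
Proof.
elim/H2W: x => c c0.
have c0' (j k : 'I_d) : (j < k)%N -> defect c j k = defect c k j.
  move=> jk; have := c0 (exist _ (j, k) jk).
  by rewrite skew_defect_class /= => /eqP; rewrite subr_eq0 => /eqP.
rewrite -(linear0 (@H2class C (PolO C d) (@eps C d))); apply/H2classP.
rewrite subr0; apply/(coboundary_defect (Z2_cocycle c)) => j k.
by case: (ltngtP j k) => [/c0'|/c0'|/val_inj ->].
Qed.

Lemma skew_defect_dual (c : pairs -> Z2 (@eps C d)) :
    (forall p j k, defect (c p) j k = delta_mx (val p).1 (val p).2 j k) ->
  forall p q, skew_defect p (H2class (c q)) = (p == q)%:R.
Proof.
move=> cE p q; rewrite skew_defect_class !cE !mxE -[p == q]val_eqE.
case: p q => [[i j] /= ij] [[k l] /= kl].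
(* Both pairs are increasing, so the transposed entry contributes nothing. *)
have -> : (j == k) && (i == l) = false.
  by apply/andP => -[/eqP jk /eqP il]; move: kl; rewrite -jk -il ltnNge ltnW.
by rewrite subr0 xpair_eqE.
Qed.

Lemma exists_dual_cocycles : exists c : pairs -> Z2 (@eps C d),
  forall p j k, defect (c p) j k = delta_mx (val p).1 (val p).2 j k.
Proof.
suff cP (p : pairs) : exists c : Z2 (@eps C d),
    forall j k, defect c j k = delta_mx (val p).1 (val p).2 j k.
  by have [c cE] := choice cP; exists c.
case: p => -[m n] /= mn.
(* For $m \ne n$, $e_{mn} = e_{mm}(e_{mn} + e_{nm})$ is a product of symmetric matrices. *)
have [||c cE] := @exists_cocycle_defect C d (delta_mx m m)
    (delta_mx m n + delta_mx n m).
- by rewrite trmx_delta.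
- by rewrite linearD /= !trmx_delta addrC.
exists c => j k; rewrite cE mulmxDr !mul_delta_mx_cond eqxx.
by rewrite -val_eqE /= ltn_eqF // addr0.
Qed.

Lemma defect_Khat (l m n j k : 'I_d) : l != m -> l != n -> m != n ->
  defect (Khat C l m n) j k = delta_mx m n j k.
Proof.
move=> lm ln mn.
have [sg _ _] := @gen_orthogonal C d.
(* The generators are selfadjoint and [Zmx] has real entries, so the star and the conjugation in [K]
   disappear. *)
transitivity ((Zmx C l m *m (Zmx C l n)^T) j k).
  rewrite mxE; apply: eq_bigr => p _; rewrite /= /K sg.
  have [_ ->] := gaussP (Zmx_skew C l m); have [_ ->] := gaussP (Zmx_skew C l n).
  by rewrite !mxE rmorphB /= !conjC_nat.
(* In $(e_{lm} - e_{ml})(e_{nl} - e_{ln})$ only $e_{ml} e_{ln} = e_{mn}$ survives. *)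
rewrite /Zmx linearB /= !trmx_delta mulmxBl !mulmxBr !mul_delta_mx_cond eqxx.
by rewrite [m == l]eq_sym (negPf lm) (negPf mn) (negPf ln) !mulr0n !sub0r oppr0 add0r opprK.
Qed.

End Coordinates.

Theorem theorem4p9 (R : realType) (d : nat) :
  (exists f : {linear H2 (@eps R[i] d) -> 'rV[R[i]]_((d * (d - 1)) %/ 2)},
      bijective f) /\
  ((3 <= d)%N ->
   forall l : 'I_d -> 'I_d -> 'I_d,
     (forall m n : 'I_d, (m < n)%N -> l m n != m /\ l m n != n) ->
     is_basis (fun p : {p : 'I_d * 'I_d | (p.1 < p.2)%N} =>
       let m := (val p).1 in let n := (val p).2 in
       H2class (Khat R[i] (l m n) m n))).
Proof.
split.
  have [c cE] := exists_dual_cocycles R[i] d.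
  apply: (dual_linear_bijection (@skew_defect_linear _ d) (@skew_defect_inj _ d)
    (skew_defect_dual cE)).
  exact: card_ltn_pairs.
move=> _ l hl.
apply: (dual_is_basis (@skew_defect_linear _ d) (@skew_defect_inj _ d)).
apply: (skew_defect_dual (c := fun p : {p : 'I_d * 'I_d | (p.1 < p.2)%N} =>
  Khat R[i] (l (val p).1 (val p).2) (val p).1 (val p).2)) => p j k.
have [lm ln] := hl _ _ (valP p).
by rewrite defect_Khat // -val_eqE /= ltn_eqF // (valP p).
Qed.
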